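(* Let $\mathcal{S}=(\mathcal{C},T,R,\mathfrak{l},\mathfrak{t},\mathfrak{r})$ be a braided pair of monads and let $\varphi:R\to T$ be a braid preserving monad morphism. Then the data $({}_R\mathcal{C}_R,\ \mathcal{C},\ \overline{T}_o,\ \overline{T}_i,\ \Pi,\ \overline{\mathfrak{t}},\ \mathfrak{i})$, consisting of the categories $\mathcal{M}:={}_R\mathcal{C}_R$ and $\mathcal{C}$, the monads $(\overline{T}_o,\overline{t}_o,\overline{\tau}_o)$ and $(\overline{T}_i,\overline{t}_i,\overline{\tau}_i)$ on ${}_R\mathcal{C}_R$, the functor $\Pi:{}_R\mathcal{C}_R\to\mathcal{C}$, and the natural transformations $\overline{\mathfrak{t}}:\overline{T}_i\overline{T}_o\to\overline{T}_o\overline{T}_i$ and $\mathfrak{i}:\Pi\overline{T}_o\to\Pi\overline{T}_i$, constitute an admissible septuple. Moreover, a transposition morphism for this admissible septuple consists of an $(R,R)$-bimodule $X$ and an $(R,R)$-bimodule map $w:\overline{T}_iX\to\overline{T}_oX$ such that, putting $\widetilde{w}:=w\circ\pi_iX$, $$\widetilde{w}\circ\tau X=\overline{\tau}_oX\qquad\text{and}\qquad \widetilde{w}\circ tX=\overline{t}_oX\circ\overline{T}_o\widetilde{w}\circ\mathfrak{t}'X\circ T\widetilde{w}\circ\mathfrak{t}X$$ (that is, such a pair $(X,w)$ is a transposition morphism if and only if these two identities hold).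
   Context: Notation. Composition of functors is juxtaposition, $\circ$ is composition of morphisms (vertical composition of natural transformations); for $\mu:F\to F'$, $G\mu X$ denotes $G(\mu_X)$ and $\mu GX$ denotes $\mu_{GX}$. Forgetful functors are omitted when harmless. Monads. A monad on $\mathcal{C}$ is a triple $(R,r,\rho)$ with multiplication $r:RR\to R$ and unit $\rho:\mathrm{Id}\to R$. A morphism of monads $\varphi:(R,r,\rho)\to(T,t,\tau)$ is a natural transformation with $\varphi\circ r=t\circ\varphi T\circ R\varphi$ and $\varphi\circ\rho=\tau$. An $R$-module is $(X,x)$ with $x:RX\to X$, $x\circ Rx=x\circ rX$, $x\circ\rho X=\mathrm{Id}_X$; morphisms commute with the actions. Distributive laws. A distributive law $\mathfrak{l}:RT\to TR$ between monads $(R,r,\rho)$ and $(T,t,\tau)$ is a natural transformation with $\mathfrak{l}\circ rT=Tr\circ\mathfrak{l}R\circ R\mathfrak{l}$, $\mathfrak{l}\circ Rt=tR\circ T\mathfrak{l}\circ\mathfrak{l}T$, $\mathfrak{l}\circ\rho T=T\rho$, $\mathfrak{l}\circ R\tau=\tau R$. A BD-law on $(T,t,\tau)$ is a distributive law $\mathfrak{t}:TT\to TT$ with $\mathfrak{t}T\circ T\mathfrak{t}\circ\mathfrak{t}T=T\mathfrak{t}\circ\mathfrak{t}T\circ T\mathfrak{t}$. Braided pair of monads. This is a sextuple $(\mathcal{C},T,R,\mathfrak{l},\mathfrak{t},\mathfrak{r})$ where: $\mathcal{C}$ is a category in which any pair of parallel morphisms has a coequalizer; $(R,r,\rho)$ and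 $(T,t,\tau)$ are monads on $\mathcal{C}$, both preserving coequalizers; $\mathfrak{l}:RT\to TR$ is an invertible distributive law; $\mathfrak{t}:TT\to TT$ and $\mathfrak{r}:RR\to RR$ are invertible BD-laws; and (A1) $T\mathfrak{r}\circ\mathfrak{l}R\circ R\mathfrak{l}=\mathfrak{l}R\circ R\mathfrak{l}\circ\mathfrak{r}T$, (A2) $\mathfrak{t}R\circ T\mathfrak{l}\circ\mathfrak{l}T=T\mathfrak{l}\circ\mathfrak{l}T\circ R\mathfrak{t}$. A morphism of monads $\varphi:R\to T$ is braid preserving if (A3) $\varphi R\circ\mathfrak{r}=\mathfrak{l}\circ R\varphi$ and $R\varphi\circ\mathfrak{r}=\mathfrak{l}^{-1}\circ\varphi R$, (A4) $\mathfrak{t}\circ\varphi T=T\varphi\circ\mathfrak{l}$ and $\mathfrak{t}\circ T\varphi=\varphi T\circ\mathfrak{l}^{-1}$. Bimodules. $R^{\mathfrak{r}}$ denotes the monad with underlying functor $R$, multiplication $r\circ\mathfrak{r}$ and unit $\rho$. An $(R,R)$-bimodule is a triple $(X,x,x^0)$ with $(X,x)$ an $R$-module, $(X,x^0)$ an $R^{\mathfrak{r}}$-module and $x\circ Rx^0\circ\mathfrak{r}X=x^0\circ Rx$. Bimodule morphisms commute with both actions; the category is ${}_R\mathcal{C}_R$. Functors $T_i,T_o:{}_R\mathcal{C}_R\to{}_R\mathcal{C}_R$. For an $(R,R)$-bimodule $(X,x,x^0)$: $T_iX=(TX,x_i,x_i^0)$ with $x_i=Tx\circ\mathfrak{l}X$,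 $x_i^0=tX\circ T\varphi X\circ\mathfrak{l}X$; $T_oX=(TX,x_o,x_o^0)$ with $x_o=tX\circ\varphi TX$, $x_o^0=Tx^0\circ\mathfrak{l}X$; both send a morphism $f$ to $Tf$. Monads $\overline{T}_o,\overline{T}_i$ on ${}_R\mathcal{C}_R$. As objects of $\mathcal{C}$, $(\overline{T}_oX,\pi_oX)=\mathrm{Coeq}(x_i,x_i^0)$ and $(\overline{T}_iX,\pi_iX)=\mathrm{Coeq}(x_o,x_o^0)$, with the unique bimodule structures such that $\pi_oX:T_oX\to\overline{T}_oX$ and $\pi_iX:T_iX\to\overline{T}_iX$ are bimodule morphisms. The units are $\overline{\tau}_o=\pi_o\circ\tau$ and $\overline{\tau}_i=\pi_i\circ\tau$. The multiplications are the unique morphisms with $\overline{t}_oX\circ\pi_o\overline{T}_oX\circ T\pi_oX=\pi_oX\circ tX$ and $\overline{t}_iX\circ\pi_i\overline{T}_iX\circ T\pi_iX=\pi_iX\circ tX\circ\mathfrak{t}^{-1}X$. Functor $\Pi:{}_R\mathcal{C}_R\to\mathcal{C}$: $(\Pi X,pX)=\mathrm{Coeq}(x,x^0)$ for $(X,x,x^0)$, and $\Pi f$ is the unique morphism with $\Pi f\circ pX=pY\circ f$. Natural transformations: $\mathfrak{t}':T_i\overline{T}_o\to\overline{T}_oT_i$ is the (unique) one with $\mathfrak{t}'\circ T_i\pi_o=\pi_oT_i\circ\mathfrak{t}$; $\overline{\mathfrak{t}}:\overline{T}_i\overline{T}_o\to\overline{T}_o\overline{T}_i$ is the one with $\pi_o\overline{T}_i\circ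 T_o\pi_i\circ\mathfrak{t}=\overline{\mathfrak{t}}\circ\pi_i\overline{T}_o\circ T_i\pi_o$; $\mathfrak{i}:\Pi\overline{T}_o\to\Pi\overline{T}_i$ is the one with $\mathfrak{i}\circ p\overline{T}_o\circ\pi_o=p\overline{T}_i\circ\pi_i$. Admissible septuple. This consists of data $(\mathcal{M},\mathcal{C},\mathbf{T}_o,\mathbf{T}_i,\boldsymbol{\Pi},\boldsymbol{t},\boldsymbol{i})$ where $\mathcal{M},\mathcal{C}$ are categories, $(\mathbf{T}_o,\mu_o,\eta_o)$ and $(\mathbf{T}_i,\mu_i,\eta_i)$ are monads on $\mathcal{M}$, $\boldsymbol{\Pi}:\mathcal{M}\to\mathcal{C}$ is a functor, $\boldsymbol{t}:\mathbf{T}_i\mathbf{T}_o\to\mathbf{T}_o\mathbf{T}_i$ is a distributive law, and $\boldsymbol{i}:\boldsymbol{\Pi}\mathbf{T}_o\to\boldsymbol{\Pi}\mathbf{T}_i$ is a natural transformation, such that $\boldsymbol{i}\circ\boldsymbol{\Pi}\eta_o=\boldsymbol{\Pi}\eta_i$ and $\boldsymbol{i}\circ\boldsymbol{\Pi}\mu_o=\boldsymbol{\Pi}\mu_i\circ\boldsymbol{i}\mathbf{T}_i\circ\boldsymbol{\Pi}\boldsymbol{t}\circ\boldsymbol{i}\mathbf{T}_o$. A transposition morphism for it is a pair $(X,w)$ of an object $X$ of $\mathcal{M}$ and a morphism $w:\mathbf{T}_iX\to\mathbf{T}_oX$ in $\mathcal{M}$ with $w\circ\eta_iX=\eta_oX$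 and $w\circ\mu_iX=\mu_oX\circ\mathbf{T}_ow\circ\boldsymbol{t}X\circ\mathbf{T}_iw$. *)

(* Defs.v *)
From mathcomp Require Import ssreflect ssrfun ssrbool.
From Stdlib Require Import ProofIrrelevance IndefiniteDescription.

Set Implicit Arguments.
Unset Strict Implicit.
Unset Printing Implicit Defensive.

Declare Scope cat_scope.
Delimit Scope cat_scope with cat.
Open Scope cat_scope.

Reserved Notation "g ∘ f" (at level 40, left associativity).
Reserved Notation "F ⋅ G" (at level 39, right associativity).

Record category := Category {
  ob :> Type;
  Hom : ob -> ob -> Type;
  idm : forall X, Hom X X;
  compm : forall X Y Z, Hom Y Z -> Hom X Y -> Hom X Z;
  compmA : forall X Y Z W (h : Hom Z W) (g : Hom Y Z) (f : Hom X Y),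
    compm h (compm g f) = compm (compm h g) f;
  comp1m : forall X Y (f : Hom X Y), compm (idm Y) f = f;
  compm1 : forall X Y (f : Hom X Y), compm f (idm X) = f }.

Arguments Hom {c} X Y.
Arguments idm {c} X.
Arguments compm {c X Y Z} g f.
Notation "g ∘ f" := (compm g f) : cat_scope.

Record functor (C D : category) := Functor {
  fob :> C -> D;
  fmap : forall X Y, Hom X Y -> Hom (fob X) (fob Y);
  fmap1 : forall X, fmap (idm X) = idm (fob X);
  fmapM : forall X Y Z (g : Hom Y Z) (f : Hom X Y),
    fmap (g ∘ f) = fmap g ∘ fmap f }.

Arguments fmap {C D} F {X Y} f : rename.

Definition idF (C : category) : functor C C :=
  @Functor C C (fun X => X) (fun X Y f => f) (fun X => erefl) (fun X Y Z g f => erefl).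

Section FunctorComposition.
Variables (C D E : category) (F : functor D E) (G : functor C D).

Lemma compF1 (X : C) : fmap F (fmap G (idm X)) = idm (F (G X)).
Proof. by rewrite !fmap1. Qed.

Lemma compFM (X Y Z : C) (g : Hom Y Z) (f : Hom X Y) :
  fmap F (fmap G (g ∘ f)) = fmap F (fmap G g) ∘ fmap F (fmap G f).
Proof. by rewrite !fmapM. Qed.

Definition compF : functor C E :=
  @Functor C E (fun X => F (G X)) (fun X Y f => fmap F (fmap G f)) compF1 compFM.

End FunctorComposition.

Notation "F ⋅ G" := (compF F G) : cat_scope.

Record nat_trans (C D : category) (F G : functor C D) := NatTrans {
  nt :> forall X, Hom (F X) (G X);
  natural : forall X Y (f : Hom X Y), nt Y ∘ fmap F f = fmap G f ∘ nt X }.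

Record nat_iso (C D : category) (F G : functor C D) := NatIso {
  iso_fwd :> nat_trans F G;
  iso_inv : nat_trans G F;
  iso_fwdK : forall X, iso_inv X ∘ iso_fwd X = idm (F X);
  iso_invK : forall X, iso_fwd X ∘ iso_inv X = idm (G X) }.

Section VerticalComposition.
Variables (C D : category) (F G H : functor C D).
Variables (b : nat_trans G H) (a : nat_trans F G).

Lemma comp_nt_natural X Y (f : Hom X Y) :
  (b Y ∘ a Y) ∘ fmap F f = fmap H f ∘ (b X ∘ a X).
Proof. by rewrite -compmA natural compmA natural compmA. Qed.

Definition comp_nt : nat_trans F H :=
  @NatTrans C D F H (fun X => b X ∘ a X) comp_nt_natural.

End VerticalComposition.

Definition is_coequalizer (C : category) (X Y Q : C) (f g : Hom X Y) (q : Hom Y Q) : Prop :=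
  q ∘ f = q ∘ g /\
  forall (Z : C) (h : Hom Y Z), h ∘ f = h ∘ g -> exists! u : Hom Q Z, u ∘ q = h.

Record coequalizer (C : category) (X Y : C) (f g : Hom X Y) := Coequalizer {
  coeq_ob : C;
  coeq_map : Hom Y coeq_ob;
  coeqP : is_coequalizer f g coeq_map }.

Definition preserves_coequalizers (C D : category) (F : functor C D) : Prop :=
  forall (X Y Q : C) (f g : Hom X Y) (q : Hom Y Q),
    is_coequalizer f g q -> is_coequalizer (fmap F f) (fmap F g) (fmap F q).

Section Descent.
Variables (C : category) (X Y Q : C) (f g : Hom X Y) (q : Hom Y Q).
Hypothesis q_coeq : is_coequalizer f g q.

Definition desc (Z : C) (h : Hom Y Z) (e : h ∘ f = h ∘ g) : Hom Q Z :=
  proj1_sig (constructive_definite_description _ (proj2 q_coeq Z h e)).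

Lemma descE (Z : C) (h : Hom Y Z) (e : h ∘ f = h ∘ g) : desc e ∘ q = h.
Proof. exact: (proj2_sig (constructive_definite_description _ (proj2 q_coeq Z h e))). Qed.

Lemma coeq_eq : q ∘ f = q ∘ g.
Proof. exact: (proj1 q_coeq). Qed.

Lemma coeq_epi (Z : C) (u v : Hom Q Z) : u ∘ q = v ∘ q -> u = v.
Proof.
move=> e.
have e' : (v ∘ q) ∘ f = (v ∘ q) ∘ g by rewrite -!compmA coeq_eq.
by have [w [_ uniq_w]] := proj2 q_coeq Z _ e'; rewrite -(uniq_w u e) -(uniq_w v erefl).
Qed.

End Descent.

Record monad_data (C : category) := MonadData {
  endo :> functor C C;
  mmult : nat_trans (endo ⋅ endo) endo;
  munit : nat_trans (idF C) endo }.

Definition is_monad (C : category) (M : monad_data C) : Prop :=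
  [/\ forall X, mmult M X ∘ fmap M (mmult M X) = mmult M X ∘ mmult M (M X),
      forall X, mmult M X ∘ fmap M (munit M X) = idm (M X)
    & forall X, mmult M X ∘ munit M (M X) = idm (M X)].

Definition is_monad_morphism (C : category) (R T : monad_data C) (phi : nat_trans R T) : Prop :=
  (forall X, phi X ∘ mmult R X = mmult T X ∘ phi (T X) ∘ fmap R (phi X)) /\
  (forall X, phi X ∘ munit R X = munit T X).

Definition is_module (C : category) (R : monad_data C) (X : C) (x : Hom (R X) X) : Prop :=
  x ∘ fmap R x = x ∘ mmult R X /\ x ∘ munit R X = idm X.

Definition is_distributive_law (C : category) (R T : monad_data C)
    (l : nat_trans (R ⋅ T) (T ⋅ R)) : Prop :=
  [/\ forall X, l X ∘ mmult R (T X) = fmap T (mmult R X) ∘ l (R X) ∘ fmap R (l X),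
      forall X, l X ∘ fmap R (mmult T X) = mmult T (R X) ∘ fmap T (l X) ∘ l (T X),
      forall X, l X ∘ munit R (T X) = fmap T (munit R X)
    & forall X, l X ∘ fmap R (munit T X) = munit T (R X)].

Definition is_BD_law (C : category) (T : monad_data C) (t : nat_trans (T ⋅ T) (T ⋅ T)) : Prop :=
  is_distributive_law t /\
  (forall X, t (T X) ∘ fmap T (t X) ∘ t (T X) = fmap T (t X) ∘ t (T X) ∘ fmap T (t X)).

Record braided_pair := BraidedPair {
  bp_cat :> category;
  bp_coeq : forall (X Y : bp_cat) (f g : Hom X Y), coequalizer f g;
  bp_T : monad_data bp_cat;
  bp_R : monad_data bp_cat;
  bp_T_monad : is_monad bp_T;
  bp_R_monad : is_monad bp_R;
  bp_T_coeq : preserves_coequalizers bp_T;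
  bp_R_coeq : preserves_coequalizers bp_R;
  bp_l : nat_iso (bp_R ⋅ bp_T) (bp_T ⋅ bp_R);
  bp_l_law : is_distributive_law bp_l;
  bp_t : nat_iso (bp_T ⋅ bp_T) (bp_T ⋅ bp_T);
  bp_t_BD : is_BD_law bp_t;
  bp_r : nat_iso (bp_R ⋅ bp_R) (bp_R ⋅ bp_R);
  bp_r_BD : is_BD_law bp_r;
  bp_A1 : forall X,
    fmap bp_T (bp_r X) ∘ bp_l (bp_R X) ∘ fmap bp_R (bp_l X)
    = bp_l (bp_R X) ∘ fmap bp_R (bp_l X) ∘ bp_r (bp_T X);
  bp_A2 : forall X,
    bp_t (bp_R X) ∘ fmap bp_T (bp_l X) ∘ bp_l (bp_T X)
    = fmap bp_T (bp_l X) ∘ bp_l (bp_T X) ∘ fmap bp_R (bp_t X) }.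

Record braid_preserving_morphism (S : braided_pair) := BraidPreservingMorphism {
  bpm_nt :> nat_trans (bp_R S) (bp_T S);
  bpm_monad : is_monad_morphism bpm_nt;
  bpm_A3 : forall X, bpm_nt (bp_R S X) ∘ bp_r S X = bp_l S X ∘ fmap (bp_R S) (bpm_nt X);
  bpm_A3' : forall X,
    fmap (bp_R S) (bpm_nt X) ∘ bp_r S X = iso_inv (bp_l S) X ∘ bpm_nt (bp_R S X);
  bpm_A4 : forall X, bp_t S X ∘ bpm_nt (bp_T S X) = fmap (bp_T S) (bpm_nt X) ∘ bp_l S X;
  bpm_A4' : forall X,
    bp_t S X ∘ fmap (bp_T S) (bpm_nt X) = bpm_nt (bp_T S X) ∘ iso_inv (bp_l S) X }.

(* The data of the monad [M^b], whose multiplication is that of [M] precomposed with [b]. *)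
Definition twist (C : category) (M : monad_data C) (b : nat_trans (M ⋅ M) (M ⋅ M)) : monad_data C :=
  @MonadData C M (comp_nt (mmult M) b) (munit M).

Section Bimodules.
Variable S : braided_pair.
Local Notation R := (bp_R S).
Local Notation rr := (bp_r S).

Definition is_bimodule (X : S) (x x0 : Hom (R X) X) : Prop :=
  [/\ is_module (R := R) x,
      is_module (R := twist rr) x0
    & x ∘ fmap R x0 ∘ rr X = x0 ∘ fmap R x].

Record bimodule := Bimodule {
  bm_ob :> S;
  act : Hom (R bm_ob) bm_ob;
  act0 : Hom (R bm_ob) bm_ob;
  bimoduleP : is_bimodule act act0 }.

Definition is_bimod_hom (X Y : bimodule) (f : Hom X Y) : Prop :=
  f ∘ act X = act Y ∘ fmap R f /\ f ∘ act0 X = act0 Y ∘ fmap R f.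

Record bimod_hom (X Y : bimodule) := BimodHom {
  bm_hom :> Hom X Y;
  bimod_homP : is_bimod_hom bm_hom }.

Lemma bimod_hom_eq (X Y : bimodule) (f g : bimod_hom X Y) : bm_hom f = bm_hom g -> f = g.
Proof.
case: f g => [f fP] [g gP] /= e; case: _ / e in gP *.
by rewrite (proof_irrelevance _ fP gP).
Qed.

Lemma idm_bimod_hom (X : bimodule) : is_bimod_hom (idm X).
Proof. by split; rewrite fmap1 comp1m compm1. Qed.

Lemma compm_bimod_hom (X Y Z : bimodule) (g : bimod_hom Y Z) (f : bimod_hom X Y) :
  is_bimod_hom (g ∘ f).
Proof.
have [[g1 g2] [f1 f2]] := (bimod_homP g, bimod_homP f).
by split; rewrite fmapM -compmA ?f1 ?f2 compmA ?g1 ?g2 compmA.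
Qed.

Definition bimod_cat : category.
Proof.
refine (@Category bimodule bimod_hom (fun X => BimodHom (idm_bimod_hom X))
  (fun X Y Z g f => BimodHom (compm_bimod_hom g f)) _ _ _).
- by move=> *; apply: bimod_hom_eq; apply: compmA.
- by move=> *; apply: bimod_hom_eq; apply: comp1m.
- by move=> *; apply: bimod_hom_eq; apply: compm1.
Defined.

End Bimodules.

(* Only the data; the monad and distributivity axioms are part of [is_admissible]. *)
Record septuple := Septuple {
  sM : category;
  sC : category;
  sTo : monad_data sM;
  sTi : monad_data sM;
  sPi : functor sM sC;
  st : nat_trans (sTi ⋅ sTo) (sTo ⋅ sTi);
  si : nat_trans (sPi ⋅ sTo) (sPi ⋅ sTi) }.

Definition is_admissible (S : septuple) : Prop :=
  [/\ is_monad (sTo S) /\ is_monad (sTi S),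
      is_distributive_law (st S),
      forall X, si S X ∘ fmap (sPi S) (munit (sTo S) X) = fmap (sPi S) (munit (sTi S) X)
    & forall X, si S X ∘ fmap (sPi S) (mmult (sTo S) X)
      = fmap (sPi S) (mmult (sTi S) X) ∘ si S (sTi S X) ∘ fmap (sPi S) (st S X)
        ∘ si S (sTo S X)].

Definition is_transposition (S : septuple) (X : sM S) (w : Hom (sTi S X) (sTo S X)) : Prop :=
  w ∘ munit (sTi S) X = munit (sTo S) X /\
  w ∘ mmult (sTi S) X = mmult (sTo S) X ∘ fmap (sTo S) w ∘ st S X ∘ fmap (sTi S) w.

Lemma whisker2 (C : category) (X Y Z W : C) (a : Hom Y Z) (b : Hom X Y) (k : Hom X Z) :
  a ∘ b = k -> forall h : Hom W X, a ∘ (b ∘ h) = k ∘ h.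
Proof. by move=> <- h; rewrite compmA. Qed.

Lemma whisker3 (C : category) (X Y Z V W : C) (a : Hom Y Z) (b : Hom X Y) (c : Hom V X) k :
  a ∘ (b ∘ c) = k -> forall h : Hom W V, a ∘ (b ∘ (c ∘ h)) = k ∘ h.
Proof. by move=> <- h; rewrite !compmA. Qed.

Lemma whisker4 (C : category) (X Y Z V U W : C)
    (a : Hom Y Z) (b : Hom X Y) (c : Hom V X) (d : Hom U V) k :
  a ∘ (b ∘ (c ∘ d)) = k -> forall h : Hom W U, a ∘ (b ∘ (c ∘ (d ∘ h))) = k ∘ h.
Proof. by move=> <- h; rewrite !compmA. Qed.

Ltac rnorm := rewrite /= ?fmapM -?compmA ?fmap1 ?comp1m ?compm1 /=.

(* [rw e] rewrites with [e] modulo associativity, in right-nested normal form;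
   [rwF F e] does so with the image of [e] under [F]; [rwr] and [rwFr] go from
   right to left. *)
Ltac rw_norm_in E := rewrite /= ?fmapM -?compmA ?fmap1 /= in E.
Ltac rw_use E := first
  [ rewrite -> E | rewrite -> (whisker2 E) | rewrite -> (whisker3 E) | rewrite -> (whisker4 E) ];
  rnorm; clear E.
Ltac rw_ e := let E := fresh in pose proof e as E; rw_norm_in E; rw_use E.
Ltac rwr_ e := let E := fresh in pose proof (esym e) as E; rw_norm_in E; rw_use E.
Ltac rwF_ F e := let E := fresh in
  pose proof (congr1 (fmap F) e) as E; rw_norm_in E; rw_use E.
Ltac rwFr_ F e := let E := fresh in
  pose proof (congr1 (fmap F) (esym e)) as E; rw_norm_in E; rw_use E.
Tactic Notation "rw" constr(e) := rw_ e.
Tactic Notation "rwr" constr(e) := rwr_ e.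
Tactic Notation "rwF" constr(F) constr(e) := rwF_ F e.
Tactic Notation "rwFr" constr(F) constr(e) := rwFr_ F e.

Section QuotientBimodule.
Variable S : braided_pair.
Local Notation R := (bp_R S).
Local Notation rr := (bp_r S).

Variables (Y : bimodule S) (Z Q : S) (f g : Hom Z Y) (q : Hom Y Q).
Hypothesis q_coeq : is_coequalizer f g q.
Hypothesis q_act : (q ∘ act Y) ∘ fmap R f = (q ∘ act Y) ∘ fmap R g.
Hypothesis q_act0 : (q ∘ act0 Y) ∘ fmap R f = (q ∘ act0 Y) ∘ fmap R g.

Let Rq_coeq : is_coequalizer (fmap R f) (fmap R g) (fmap R q) := bp_R_coeq q_coeq.
Let RRq_coeq : is_coequalizer (fmap R (fmap R f)) (fmap R (fmap R g)) (fmap R (fmap R q)) :=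
  bp_R_coeq Rq_coeq.

Definition quot_act : Hom (R Q) Q := desc Rq_coeq q_act.
Definition quot_act0 : Hom (R Q) Q := desc Rq_coeq q_act0.

Let q1 : quot_act ∘ fmap R q = q ∘ act Y := descE Rq_coeq q_act.
Let q2 : quot_act0 ∘ fmap R q = q ∘ act0 Y := descE Rq_coeq q_act0.

Lemma quot_is_bimodule : is_bimodule quot_act quot_act0.
Proof.
have [[y1 y2] [z1 z2] yz] := bimoduleP Y; move: y1 y2 z1 z2 yz => /= y1 y2 z1 z2 yz.
have n_r : mmult R Q ∘ fmap R (fmap R q) = fmap R q ∘ mmult R Y := natural (mmult R) q.
have n_u : munit R Q ∘ q = fmap R q ∘ munit R Y := natural (munit R) q.
have n_rr : rr Q ∘ fmap R (fmap R q) = fmap R (fmap R q) ∘ rr Y := natural rr q.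
split; [split|split|] => /=.
- apply: (coeq_epi RRq_coeq); rnorm.
  rw n_r. rw q1. rwF R q1. rw q1. by rw y1.
- apply: (coeq_epi q_coeq); rnorm. rw n_u. rw q1. by rw y2.
- apply: (coeq_epi RRq_coeq); rnorm.
  rw n_rr. rw n_r. rw q2. rwF R q2. rw q2. by rw z1.
- apply: (coeq_epi q_coeq); rnorm. rw n_u. rw q2. by rw z2.
- apply: (coeq_epi RRq_coeq); rnorm.
  rw n_rr. rwF R q2. rw q1. rwF R q1. rw q2. rwr yz. by [].
Qed.

Definition quot_bimodule : bimodule S := Bimodule quot_is_bimodule.

Lemma quot_bimodule_unique (z z0 : Hom (R Q) Q) :
  q ∘ act Y = z ∘ fmap R q -> q ∘ act0 Y = z0 ∘ fmap R q -> z = quot_act /\ z0 = quot_act0.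
Proof. by move=> e e0; split; apply: (coeq_epi Rq_coeq); rewrite ?q1 ?q2. Qed.

Lemma quot_proj_hom : @is_bimod_hom S Y quot_bimodule q.
Proof. by split; rewrite /= ?q1 ?q2. Qed.

Definition quot_proj : bimod_hom Y quot_bimodule := BimodHom quot_proj_hom.

End QuotientBimodule.

Section BimoduleDescent.
Variable S : braided_pair.
Local Notation R := (bp_R S).

Variables (Y Q W : bimodule S) (Z : S) (f g : Hom Z Y) (q : bimod_hom Y Q).
Hypothesis q_coeq : is_coequalizer f g q.
Variables (h : bimod_hom Y W) (e : h ∘ f = h ∘ g).

Lemma bimod_desc_hom : @is_bimod_hom S Q W (desc q_coeq e).
Proof.
have [q1 q2] := bimod_homP q; have [h1 h2] := bimod_homP h; have d := descE q_coeq e.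
split; apply: (coeq_epi (bp_R_coeq q_coeq)); rnorm.
- rwr q1. rwF R d. rw d. exact: h1.
- rwr q2. rwF R d. rw d. exact: h2.
Qed.

Definition bimod_desc : bimod_hom Q W := BimodHom bimod_desc_hom.

End BimoduleDescent.

Section Construction.
Variables (S : braided_pair) (phi : braid_preserving_morphism S).
Local Notation T := (bp_T S).
Local Notation R := (bp_R S).
Local Notation m := (mmult (bp_T S)).
Local Notation r := (mmult (bp_R S)).
Local Notation tau := (munit (bp_T S)).
Local Notation rho := (munit (bp_R S)).
Local Notation l := (bp_l S).
Local Notation t := (bp_t S).
Local Notation tV := (iso_inv (bp_t S)).
Local Notation rr := (bp_r S).
Local Notation coeq f g := (bp_coeq f g).

Lemma n_m (X Y : S) (f : Hom X Y) : m Y ∘ fmap T (fmap T f) = fmap T f ∘ m X.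
Proof. exact: (natural m f). Qed.
Lemma n_r (X Y : S) (f : Hom X Y) : r Y ∘ fmap R (fmap R f) = fmap R f ∘ r X.
Proof. exact: (natural r f). Qed.
Lemma n_tau (X Y : S) (f : Hom X Y) : tau Y ∘ f = fmap T f ∘ tau X.
Proof. exact: (natural tau f). Qed.
Lemma n_rho (X Y : S) (f : Hom X Y) : rho Y ∘ f = fmap R f ∘ rho X.
Proof. exact: (natural rho f). Qed.
Lemma n_l (X Y : S) (f : Hom X Y) : l Y ∘ fmap R (fmap T f) = fmap T (fmap R f) ∘ l X.
Proof. exact: (natural l f). Qed.
Lemma n_t (X Y : S) (f : Hom X Y) : t Y ∘ fmap T (fmap T f) = fmap T (fmap T f) ∘ t X.
Proof. exact: (natural t f). Qed.
Lemma n_tV (X Y : S) (f : Hom X Y) : tV Y ∘ fmap T (fmap T f) = fmap T (fmap T f) ∘ tV X.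
Proof. exact: (natural tV f). Qed.
Lemma n_rr (X Y : S) (f : Hom X Y) : rr Y ∘ fmap R (fmap R f) = fmap R (fmap R f) ∘ rr X.
Proof. exact: (natural rr f). Qed.
Lemma n_phi (X Y : S) (f : Hom X Y) : phi Y ∘ fmap R f = fmap T f ∘ phi X.
Proof. exact: (natural phi f). Qed.

Lemma mmA X : m X ∘ fmap T (m X) = m X ∘ m (T X).
Proof. by have [H _ _] := bp_T_monad S; apply: H. Qed.
Lemma mm1 X : m X ∘ fmap T (tau X) = idm (T X).
Proof. by have [_ H _] := bp_T_monad S; apply: H. Qed.
Lemma mm1' X : m X ∘ tau (T X) = idm (T X).
Proof. by have [_ _ H] := bp_T_monad S; apply: H. Qed.
Lemma phi_m X : phi X ∘ r X = m X ∘ (phi (T X) ∘ fmap R (phi X)).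
Proof. by have [H _] := bpm_monad phi; rewrite H; rnorm. Qed.
Lemma phi_u X : phi X ∘ rho X = tau X.
Proof. by have [_ H] := bpm_monad phi; apply: H. Qed.

Lemma l_r X : l X ∘ r (T X) = fmap T (r X) ∘ (l (R X) ∘ fmap R (l X)).
Proof. by have [H _ _ _] := bp_l_law S; rewrite H; rnorm. Qed.
Lemma l_m X : l X ∘ fmap R (m X) = m (R X) ∘ (fmap T (l X) ∘ l (T X)).
Proof. by have [_ H _ _] := bp_l_law S; rewrite H; rnorm. Qed.
Lemma l_rho X : l X ∘ rho (T X) = fmap T (rho X).
Proof. by have [_ _ H _] := bp_l_law S; apply: H. Qed.
Lemma l_tau X : l X ∘ fmap R (tau X) = tau (R X).
Proof. by have [_ _ _ H] := bp_l_law S; apply: H. Qed.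
Lemma t_m X : t X ∘ m (T X) = fmap T (m X) ∘ (t (T X) ∘ fmap T (t X)).
Proof. by have [[H _ _ _] _] := bp_t_BD S; rewrite H; rnorm. Qed.
Lemma t_m' X : t X ∘ fmap T (m X) = m (T X) ∘ (fmap T (t X) ∘ t (T X)).
Proof. by have [[_ H _ _] _] := bp_t_BD S; rewrite H; rnorm. Qed.
Lemma t_tau X : t X ∘ tau (T X) = fmap T (tau X).
Proof. by have [[_ _ H _] _] := bp_t_BD S; apply: H. Qed.
Lemma t_tau' X : t X ∘ fmap T (tau X) = tau (T X).
Proof. by have [[_ _ _ H] _] := bp_t_BD S; apply: H. Qed.
Lemma t_YB X :
  t (T X) ∘ (fmap T (t X) ∘ t (T X)) = fmap T (t X) ∘ (t (T X) ∘ fmap T (t X)).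
Proof. by have [_ H] := bp_t_BD S; have := H X; rnorm. Qed.
Lemma l_rr X :
  fmap T (rr X) ∘ (l (R X) ∘ fmap R (l X)) = l (R X) ∘ (fmap R (l X) ∘ rr (T X)).
Proof. by have := bp_A1 X; rnorm. Qed.
Lemma l_t X :
  t (R X) ∘ (fmap T (l X) ∘ l (T X)) = fmap T (l X) ∘ (l (T X) ∘ fmap R (t X)).
Proof. by have := bp_A2 X; rnorm. Qed.

Lemma tK X : tV X ∘ t X = idm (T (T X)). Proof. exact: iso_fwdK. Qed.
Lemma tK' X : t X ∘ tV X = idm (T (T X)). Proof. exact: iso_invK. Qed.
Lemma lK X : iso_inv l X ∘ l X = idm (R (T X)). Proof. exact: iso_fwdK. Qed.
Lemma lK' X : l X ∘ iso_inv l X = idm (T (R X)). Proof. exact: iso_invK. Qed.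

Lemma phi_rr X : l X ∘ fmap R (phi X) = phi (R X) ∘ rr X.
Proof. by rewrite bpm_A3. Qed.
Lemma phi_rr' X : l X ∘ (fmap R (phi X) ∘ rr X) = phi (R X).
Proof. by rewrite bpm_A3' compmA lK' comp1m. Qed.
Lemma phi_t X : t X ∘ phi (T X) = fmap T (phi X) ∘ l X.
Proof. exact: bpm_A4. Qed.
Lemma phi_t' X : t X ∘ (fmap T (phi X) ∘ l X) = phi (T X).
Proof. by rewrite compmA bpm_A4' -compmA lK compm1. Qed.

Lemma l_epi X Z (u v : Hom (T (R X)) Z) : u ∘ l X = v ∘ l X -> u = v.
Proof. by move=> e; rewrite -(compm1 u) -(compm1 v) -(lK' X) !compmA e. Qed.
Lemma t_epi X Z (u v : Hom (T (T X)) Z) : u ∘ t X = v ∘ t X -> u = v.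
Proof. by move=> e; rewrite -(compm1 u) -(compm1 v) -(tK' X) !compmA e. Qed.
Lemma Rt_epi X Z (u v : Hom (R (T (T X))) Z) : u ∘ fmap R (t X) = v ∘ fmap R (t X) -> u = v.
Proof.
by move=> e; rewrite -(compm1 u) -(compm1 v) -(fmap1 R) -(tK' X) fmapM !compmA e.
Qed.
Lemma rr_epi X Z (u v : Hom (R (R X)) Z) : u ∘ rr X = v ∘ rr X -> u = v.
Proof.
by move=> e; rewrite -(compm1 u) -(compm1 v) -(iso_invK rr X) !compmA e.
Qed.

Section Actions.
Variable X : bimodule S.
Local Notation x := (act X).
Local Notation x0 := (act0 X).

Definition act_i : Hom (R (T X)) (T X) := fmap T x ∘ l X.
Definition act0_i : Hom (R (T X)) (T X) := m X ∘ fmap T (phi X) ∘ l X.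
Definition act_o : Hom (R (T X)) (T X) := m X ∘ phi (T X).
Definition act0_o : Hom (R (T X)) (T X) := fmap T x0 ∘ l X.

Lemma x_r : x ∘ fmap R x = x ∘ r X. Proof. by have [[]] := bimoduleP X. Qed.
Lemma x_rho : x ∘ rho X = idm X. Proof. by have [[]] := bimoduleP X. Qed.
Lemma x0_r : x0 ∘ fmap R x0 = x0 ∘ (r X ∘ rr X). Proof. by have [_ []] := bimoduleP X. Qed.
Lemma x0_rho : x0 ∘ rho X = idm X. Proof. by have [_ []] := bimoduleP X. Qed.
Lemma x_x0 : x ∘ (fmap R x0 ∘ rr X) = x0 ∘ fmap R x.
Proof. by have [_ _] := bimoduleP X; rnorm. Qed.

Lemma Ti_is_bimodule : is_bimodule act_i act0_i.
Proof.
rewrite /act_i /act0_i; split; [split|split|]; rnorm.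
- rw (n_l x). rw (l_r X). by rwF T x_r.
- rw (l_rho X). by rwF T x_rho.
- rw (l_m X). rw (n_l (phi X)). rw (l_r X). rwF T (phi_m X). rwF T (phi_rr X).
  rw (l_rr X). rwr (n_m (phi X)). rwF T (n_phi (phi X)). rw (mmA X). by [].
- rw (l_rho X). rwF T (phi_u X). by rw (mm1 X).
- rw (l_m X). rw (n_l (phi X)). rwr (l_rr X). rwF T (phi_rr' X).
  rw (n_l x). rwF T (n_phi x). by rwr (n_m x).
Qed.

Lemma To_is_bimodule : is_bimodule act_o act0_o.
Proof.
rewrite /act_o /act0_o; split; [split|split|]; rnorm.
- rw (n_phi (m X)). rw (mmA X). rw (phi_m (T X)). rwr (mmA X). by rw (n_phi (phi (T X))).
- rw (phi_u (T X)). by rw (mm1' X).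
- rw (n_l x0). rwF T x0_r. rw (l_rr X). by rw (l_r X).
- rw (l_rho X). by rwF T x0_rho.
- rw (n_phi (fmap T x0)). rw (n_m x0). rw (n_phi (l X)). rw (l_m X).
  rwr (phi_rr (T X)). by [].
Qed.

Lemma act_io : act_i ∘ fmap R act_o = act_o ∘ fmap R act_i ∘ rr (T X).
Proof.
rewrite /act_i /act_o; rnorm. rw (l_m X). rw (phi_rr (T X)).
rw (n_phi (fmap T x)). rw (n_m x). by rw (n_phi (l X)).
Qed.

Lemma act_oi : act_o ∘ fmap R act_i = act_i ∘ fmap R act_o ∘ rr (T X).
Proof.
rewrite /act_i /act_o; rnorm. rw (l_m X). rw (phi_rr' (T X)).
rw (n_phi (fmap T x)). rw (n_m x). by rw (n_phi (l X)).
Qed.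

Lemma act_i0o : act0_i ∘ fmap R act_o = act_o ∘ fmap R act0_i ∘ rr (T X).
Proof.
rewrite /act0_i /act_o; rnorm. rw (l_m X). rw (phi_rr (T X)).
rwr (n_m (phi X)). rw (n_phi (m X)). rw (n_phi (fmap T (phi X))). rw (n_phi (l X)).
by rw (mmA X).
Qed.

Lemma act_oi0 : act_o ∘ fmap R act0_i = act0_i ∘ fmap R act_o ∘ rr (T X).
Proof.
rewrite /act0_i /act_o; rnorm. rw (l_m X). rw (phi_rr' (T X)).
rwr (n_m (phi X)). rw (n_phi (m X)). rw (n_phi (fmap T (phi X))). rw (n_phi (l X)).
by rw (mmA X).
Qed.

Lemma act_o0i : act0_o ∘ fmap R act_i = act_i ∘ fmap R act0_o ∘ rr (T X).
Proof.
rewrite /act_i /act0_o; rnorm. rw (n_l x). rw (n_l x0). rwr (l_rr X).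
by rwF T x_x0.
Qed.

Lemma act_o0i0 : act0_o ∘ fmap R act0_i = act0_i ∘ fmap R act0_o ∘ rr (T X).
Proof.
rewrite /act0_i /act0_o; rnorm. rw (l_m X). rw (n_l (phi X)). rwF T (phi_rr X).
rw (l_rr X). rw (n_l x0). rwF T (n_phi x0). by rw (n_m x0).
Qed.

Lemma act_i_m : act_i ∘ fmap R (m X) = m X ∘ (fmap T act_i ∘ l (T X)).
Proof. rewrite /act_i; rnorm. rw (l_m X). by rw (n_m x). Qed.

Lemma act0_i_m : act0_i ∘ fmap R (m X) = m X ∘ (fmap T act0_i ∘ l (T X)).
Proof.
rewrite /act0_i; rnorm. rw (l_m X). rwr (n_m (phi X)). by rw (mmA X).
Qed.

Lemma act_o_m : act_o ∘ fmap R (m X) = m X ∘ (m (T X) ∘ phi (T (T X))).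
Proof. rewrite /act_o; rnorm. rw (n_phi (m X)). by rw (mmA X). Qed.

Lemma act0_o_m : act0_o ∘ fmap R (m X) = m X ∘ (fmap T act0_o ∘ l (T X)).
Proof. rewrite /act0_o; rnorm. rw (l_m X). by rw (n_m x0). Qed.

Lemma t_act_i : t X ∘ (fmap T act_i ∘ l (T X)) = fmap T act_i ∘ (l (T X) ∘ fmap R (t X)).
Proof. rewrite /act_i; rnorm. rw (n_t x). by rw (l_t X). Qed.

Lemma t_act0_i :
  t X ∘ (fmap T act0_i ∘ l (T X)) = m (T X) ∘ (fmap T (phi (T X)) ∘ (l (T X) ∘ fmap R (t X))).
Proof.
rewrite /act0_i; rnorm. rw (t_m' X). rwFr T (phi_t X). rwr (t_YB X).
rw (phi_t' (T X)). rwr (n_phi (t X)). by rw (phi_t (T X)).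
Qed.

Lemma t_act_o : t X ∘ (fmap T act_o ∘ l (T X)) = m (T X) ∘ (phi (T (T X)) ∘ fmap R (t X)).
Proof.
rewrite /act_o; rnorm. rw (t_m' X). rw (phi_t' (T X)). by rw (n_phi (t X)).
Qed.

Lemma t_act0_o : t X ∘ (fmap T act0_o ∘ l (T X)) = fmap T act0_o ∘ (l (T X) ∘ fmap R (t X)).
Proof. rewrite /act0_o; rnorm. rw (n_t x0). by rw (l_t X). Qed.

Lemma t_m_phi : t X ∘ (m (T X) ∘ phi (T (T X))) = fmap T act_o ∘ (l (T X) ∘ fmap R (t X)).
Proof.
rewrite /act_o; rnorm. rw (t_m X). rwr (n_phi (t X)). by rw (phi_t (T X)).
Qed.

Lemma t_m_phi0 :
  t X ∘ (m (T X) ∘ (fmap T (phi (T X)) ∘ l (T X))) = fmap T act0_i ∘ (l (T X) ∘ fmap R (t X)).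
Proof.
rewrite /act0_i; rnorm. rw (t_m X). rwF T (phi_t X). rw (n_t (phi X)). by rw (l_t X).
Qed.

End Actions.

Definition Ti_ob (X : bimodule S) : bimodule S := Bimodule (Ti_is_bimodule X).
Definition To_ob (X : bimodule S) : bimodule S := Bimodule (To_is_bimodule X).

Lemma Ti_map_hom (X Y : bimodule S) (f : bimod_hom X Y) :
  @is_bimod_hom S (Ti_ob X) (Ti_ob Y) (fmap T f).
Proof.
have [f1 f2] := bimod_homP f; split; rewrite /= /act_i /act0_i; rnorm.
- rw (n_l f). by rwF T f1.
- rw (n_l f). rwF T (n_phi f). by rw (n_m f).
Qed.

Lemma To_map_hom (X Y : bimodule S) (f : bimod_hom X Y) :
  @is_bimod_hom S (To_ob X) (To_ob Y) (fmap T f).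
Proof.
have [f1 f2] := bimod_homP f; split; rewrite /= /act_o /act0_o; rnorm.
- rw (n_phi (fmap T f)). by rw (n_m f).
- rw (n_l f). by rwF T f2.
Qed.

Definition Ti : functor (bimod_cat S) (bimod_cat S).
Proof.
refine (@Functor (bimod_cat S) (bimod_cat S) Ti_ob (fun X Y f => BimodHom (Ti_map_hom f)) _ _).
- by move=> X; apply: bimod_hom_eq; apply: fmap1.
- by move=> X Y Z g f; apply: bimod_hom_eq; apply: fmapM.
Defined.

Definition To : functor (bimod_cat S) (bimod_cat S).
Proof.
refine (@Functor (bimod_cat S) (bimod_cat S) To_ob (fun X Y f => BimodHom (To_map_hom f)) _ _).
- by move=> X; apply: bimod_hom_eq; apply: fmap1.
- by move=> X Y Z g f; apply: bimod_hom_eq; apply: fmapM.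
Defined.

Section Quotients.
Variable X : bimodule S.

Definition coeq_o : coequalizer (act (Ti X)) (act0 (Ti X)) := bp_coeq (act (Ti X)) (act0 (Ti X)).
Definition coeq_i : coequalizer (act (To X)) (act0 (To X)) := bp_coeq (act (To X)) (act0 (To X)).

Lemma coeq_o_act :
  (coeq_map coeq_o ∘ act (To X)) ∘ fmap R (act (Ti X))
  = (coeq_map coeq_o ∘ act (To X)) ∘ fmap R (act0 (Ti X)).
Proof.
have e := coeq_eq (coeqP coeq_o); rewrite /= in e *; apply: (rr_epi (X := T X)); rnorm.
by rwr (act_io X); rwr (act_i0o X); rw e.
Qed.

Lemma coeq_o_act0 :
  (coeq_map coeq_o ∘ act0 (To X)) ∘ fmap R (act (Ti X))
  = (coeq_map coeq_o ∘ act0 (To X)) ∘ fmap R (act0 (Ti X)).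
Proof.
have e := coeq_eq (coeqP coeq_o); rewrite /= in e *; rnorm.
by rw (act_o0i X); rw (act_o0i0 X); rw e.
Qed.

Lemma coeq_i_act :
  (coeq_map coeq_i ∘ act (Ti X)) ∘ fmap R (act (To X))
  = (coeq_map coeq_i ∘ act (Ti X)) ∘ fmap R (act0 (To X)).
Proof.
have e := coeq_eq (coeqP coeq_i); rewrite /= in e *; apply: (rr_epi (X := T X)); rnorm.
by rwr (act_oi X); rwr (act_o0i X); rw e.
Qed.

Lemma coeq_i_act0 :
  (coeq_map coeq_i ∘ act0 (Ti X)) ∘ fmap R (act (To X))
  = (coeq_map coeq_i ∘ act0 (Ti X)) ∘ fmap R (act0 (To X)).
Proof.
have e := coeq_eq (coeqP coeq_i); rewrite /= in e *; apply: (rr_epi (X := T X)); rnorm.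
by rwr (act_oi0 X); rwr (act_o0i0 X); rw e.
Qed.

(* The index of the quotient is opposite to that of the actions: [Tbar_o X] is the
   quotient of the bimodule [T_o X] by the two actions of [T_i X], and conversely. *)
Definition Tbar_o_ob : bimodule S := quot_bimodule (Y := To X) (coeqP coeq_o) coeq_o_act coeq_o_act0.
Definition Tbar_i_ob : bimodule S := quot_bimodule (Y := Ti X) (coeqP coeq_i) coeq_i_act coeq_i_act0.

Definition pi_o_hom : bimod_hom (To X) Tbar_o_ob :=
  quot_proj (Y := To X) (coeqP coeq_o) coeq_o_act coeq_o_act0.
Definition pi_i_hom : bimod_hom (Ti X) Tbar_i_ob :=
  quot_proj (Y := Ti X) (coeqP coeq_i) coeq_i_act coeq_i_act0.

Lemma pi_o_coeq : is_coequalizer (act (Ti X)) (act0 (Ti X)) pi_o_hom.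
Proof. exact: (coeqP coeq_o). Qed.
Lemma pi_i_coeq : is_coequalizer (act (To X)) (act0 (To X)) pi_i_hom.
Proof. exact: (coeqP coeq_i). Qed.

End Quotients.

Lemma Tbar_o_map_eq (X Y : bimodule S) (f : bimod_hom X Y) :
  (pi_o_hom Y ∘ fmap T f) ∘ act (Ti X) = (pi_o_hom Y ∘ fmap T f) ∘ act0 (Ti X).
Proof.
have [f1 f2] := Ti_map_hom f; have e := coeq_eq (pi_o_coeq Y).
by rnorm; rw f1; rw f2; rw e.
Qed.

Lemma Tbar_i_map_eq (X Y : bimodule S) (f : bimod_hom X Y) :
  (pi_i_hom Y ∘ fmap T f) ∘ act (To X) = (pi_i_hom Y ∘ fmap T f) ∘ act0 (To X).
Proof.
have [f1 f2] := To_map_hom f; have e := coeq_eq (pi_i_coeq Y).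
by rnorm; rw f1; rw f2; rw e.
Qed.

Definition Tbar_o_map (X Y : bimodule S) (f : bimod_hom X Y) :
    bimod_hom (Tbar_o_ob X) (Tbar_o_ob Y) :=
  bimod_desc (q := pi_o_hom X) (pi_o_coeq X)
    (h := BimodHom (compm_bimod_hom (pi_o_hom Y) (BimodHom (To_map_hom f)))) (Tbar_o_map_eq f).

Definition Tbar_i_map (X Y : bimodule S) (f : bimod_hom X Y) :
    bimod_hom (Tbar_i_ob X) (Tbar_i_ob Y) :=
  bimod_desc (q := pi_i_hom X) (pi_i_coeq X)
    (h := BimodHom (compm_bimod_hom (pi_i_hom Y) (BimodHom (Ti_map_hom f)))) (Tbar_i_map_eq f).

Lemma Tbar_o_mapE (X Y : bimodule S) (f : bimod_hom X Y) :
  Tbar_o_map f ∘ pi_o_hom X = pi_o_hom Y ∘ fmap T f.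
Proof. exact: (descE (pi_o_coeq X) (Tbar_o_map_eq f)). Qed.

Lemma Tbar_i_mapE (X Y : bimodule S) (f : bimod_hom X Y) :
  Tbar_i_map f ∘ pi_i_hom X = pi_i_hom Y ∘ fmap T f.
Proof. exact: (descE (pi_i_coeq X) (Tbar_i_map_eq f)). Qed.

Definition Tbar_o : functor (bimod_cat S) (bimod_cat S).
Proof.
refine (@Functor (bimod_cat S) (bimod_cat S) Tbar_o_ob Tbar_o_map _ _).
- move=> X; apply: bimod_hom_eq; apply: (coeq_epi (pi_o_coeq X)).
  by rewrite Tbar_o_mapE; rnorm.
- move=> X Y Z g f; apply: bimod_hom_eq; apply: (coeq_epi (pi_o_coeq X)).
  by rewrite Tbar_o_mapE; rnorm; rw (Tbar_o_mapE f); rw (Tbar_o_mapE g).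
Defined.

Definition Tbar_i : functor (bimod_cat S) (bimod_cat S).
Proof.
refine (@Functor (bimod_cat S) (bimod_cat S) Tbar_i_ob Tbar_i_map _ _).
- move=> X; apply: bimod_hom_eq; apply: (coeq_epi (pi_i_coeq X)).
  by rewrite Tbar_i_mapE; rnorm.
- move=> X Y Z g f; apply: bimod_hom_eq; apply: (coeq_epi (pi_i_coeq X)).
  by rewrite Tbar_i_mapE; rnorm; rw (Tbar_i_mapE f); rw (Tbar_i_mapE g).
Defined.

Definition pi_o : nat_trans To Tbar_o.
Proof.
refine (@NatTrans _ _ To Tbar_o pi_o_hom _).
by move=> X Y f; apply: bimod_hom_eq; rewrite /= Tbar_o_mapE.
Defined.

Definition pi_i : nat_trans Ti Tbar_i.
Proof.
refine (@NatTrans _ _ Ti Tbar_i pi_i_hom _).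
by move=> X Y f; apply: bimod_hom_eq; rewrite /= Tbar_i_mapE.
Defined.

#[local] Opaque Tbar_o_ob Tbar_i_ob Tbar_o_map Tbar_i_map pi_o_hom pi_i_hom.

Lemma coeq_o_eq (X : bimodule S) :
  pi_o_hom X ∘ (fmap T (act X) ∘ l X) = pi_o_hom X ∘ (m X ∘ (fmap T (phi X) ∘ l X)).
Proof. by rewrite (compmA (m X)); apply: (coeq_eq (pi_o_coeq X)). Qed.

Lemma coeq_i_eq (X : bimodule S) :
  pi_i_hom X ∘ (m X ∘ phi (T X)) = pi_i_hom X ∘ (fmap T (act0 X) ∘ l X).
Proof. exact: (coeq_eq (pi_i_coeq X)). Qed.

Lemma pi_o_act (X : bimodule S) :
  pi_o_hom X ∘ (m X ∘ phi (T X)) = act (Tbar_o_ob X) ∘ fmap R (pi_o_hom X).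
Proof. exact: (proj1 (bimod_homP (pi_o_hom X))). Qed.

Lemma pi_o_act0 (X : bimodule S) :
  pi_o_hom X ∘ (fmap T (act0 X) ∘ l X) = act0 (Tbar_o_ob X) ∘ fmap R (pi_o_hom X).
Proof. exact: (proj2 (bimod_homP (pi_o_hom X))). Qed.

Lemma pi_i_act (X : bimodule S) :
  pi_i_hom X ∘ (fmap T (act X) ∘ l X) = act (Tbar_i_ob X) ∘ fmap R (pi_i_hom X).
Proof. exact: (proj1 (bimod_homP (pi_i_hom X))). Qed.

Lemma pi_i_act0 (X : bimodule S) :
  pi_i_hom X ∘ (m X ∘ (fmap T (phi X) ∘ l X)) = act0 (Tbar_i_ob X) ∘ fmap R (pi_i_hom X).
Proof. by rewrite -(proj2 (bimod_homP (pi_i_hom X))) /= /act0_i -!compmA. Qed.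

Lemma t_hom (X : bimodule S) : @is_bimod_hom S (Ti (To X)) (To (Ti X)) (t X).
Proof.
split; rnorm.
- rewrite /act_o; rnorm; exact: t_act_o.
- by rewrite /act0_i; rnorm; rw (t_m_phi0 X); rewrite /act0_i; rnorm.
Qed.

Definition t_nat : nat_trans (Ti ⋅ To) (To ⋅ Ti).
Proof.
refine (@NatTrans _ _ (Ti ⋅ To) (To ⋅ Ti) (fun X => BimodHom (t_hom X)) _).
by move=> X Y f; apply: bimod_hom_eq; apply: n_t.
Defined.

Lemma T_pi_o_coeq (X : bimodule S) :
  is_coequalizer (fmap T (act (Ti X))) (fmap T (act0 (Ti X))) (fmap T (pi_o_hom X)).
Proof. exact: bp_T_coeq (pi_o_coeq X). Qed.

Lemma T_pi_i_coeq (X : bimodule S) :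
  is_coequalizer (fmap T (act (To X))) (fmap T (act0 (To X))) (fmap T (pi_i_hom X)).
Proof. exact: bp_T_coeq (pi_i_coeq X). Qed.

Lemma tprime_eq (X : bimodule S) :
  (pi_o_hom (Ti X) ∘ t X) ∘ fmap T (act (Ti X))
  = (pi_o_hom (Ti X) ∘ t X) ∘ fmap T (act0 (Ti X)).
Proof.
apply: (l_epi (X := T X)); rnorm.
rw (t_act_i X). rw (t_act0_i X). by rw (coeq_o_eq (Ti X)).
Qed.

Definition tprime_hom (X : bimodule S) : bimod_hom (Ti (Tbar_o X)) (Tbar_o (Ti X)) :=
  bimod_desc (q := fmap Ti (pi_o X)) (T_pi_o_coeq X)
    (h := pi_o (Ti X) ∘ t_nat X) (tprime_eq X).

Lemma tprime_homE (X : bimodule S) :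
  tprime_hom X ∘ fmap T (pi_o_hom X) = pi_o_hom (Ti X) ∘ t X.
Proof. exact: (descE (T_pi_o_coeq X) (tprime_eq X)). Qed.

Definition tprime : nat_trans (Ti ⋅ Tbar_o) (Tbar_o ⋅ Ti).
Proof.
refine (@NatTrans _ _ (Ti ⋅ Tbar_o) (Tbar_o ⋅ Ti) tprime_hom _).
move=> X Y f; apply: bimod_hom_eq; apply: (coeq_epi (T_pi_o_coeq X)); rnorm.
rw (tprime_homE X). rwF T (Tbar_o_mapE f). rw (tprime_homE Y).
rw (Tbar_o_mapE (fmap Ti f)). by rw (n_t f).
Defined.

Lemma tbar_eq (X : bimodule S) :
  (Tbar_o_map (pi_i_hom X) ∘ tprime_hom X) ∘ act (To (Tbar_o X))
  = (Tbar_o_map (pi_i_hom X) ∘ tprime_hom X) ∘ act0 (To (Tbar_o X)).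
Proof.
apply: (coeq_epi (bp_R_coeq (T_pi_o_coeq X))); rewrite /= /act_o /act0_o; rnorm.
rw (n_phi (fmap T (pi_o_hom X))). rw (n_m (pi_o_hom X)). rw (n_l (pi_o_hom X)).
rwFr T (pi_o_act0 X).
rw (tprime_homE X). rw (Tbar_o_mapE (pi_i_hom X)).
rw (tprime_homE X). rw (Tbar_o_mapE (pi_i_hom X)).
rw (t_m_phi X). rw (t_act0_o X).
by rwF T (coeq_i_eq X).
Qed.

Definition tbar_hom (X : bimodule S) : bimod_hom (Tbar_i (Tbar_o X)) (Tbar_o (Tbar_i X)) :=
  bimod_desc (q := pi_i (Tbar_o X)) (pi_i_coeq (Tbar_o X))
    (h := fmap Tbar_o (pi_i X) ∘ tprime X) (tbar_eq X).

Lemma tbar_homE' (X : bimodule S) :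
  tbar_hom X ∘ pi_i_hom (Tbar_o X) = Tbar_o_map (pi_i_hom X) ∘ tprime_hom X.
Proof. exact: (descE (pi_i_coeq (Tbar_o X)) (tbar_eq X)). Qed.

Lemma tbar_homE (X : bimodule S) :
  pi_o_hom (Tbar_i X) ∘ fmap T (pi_i_hom X) ∘ t X
  = tbar_hom X ∘ pi_i_hom (Tbar_o X) ∘ fmap T (pi_o_hom X).
Proof.
rnorm. rw (tbar_homE' X). rw (tprime_homE X). by rw (Tbar_o_mapE (pi_i_hom X)).
Qed.

Definition tbar : nat_trans (Tbar_i ⋅ Tbar_o) (Tbar_o ⋅ Tbar_i).
Proof.
refine (@NatTrans _ _ (Tbar_i ⋅ Tbar_o) (Tbar_o ⋅ Tbar_i) tbar_hom _).
move=> X Y f; apply: bimod_hom_eq; apply: (coeq_epi (pi_i_coeq (Tbar_o X))).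
apply: (coeq_epi (T_pi_o_coeq X)).
have eX := tbar_homE X; have eY := tbar_homE Y.
rnorm. rw (Tbar_i_mapE (fmap Tbar_o f)). rwF T (Tbar_o_mapE f).
rwr eX. rwr eY. rw (Tbar_o_mapE (fmap Tbar_i f)). rwF T (Tbar_i_mapE f). by rw (n_t f).
Defined.

Lemma m_hom_o (X : bimodule S) : @is_bimod_hom S (To (To X)) (To X) (m X).
Proof.
by split; [apply: esym (act_o_m X) | apply: esym (act0_o_m X)].
Qed.

Lemma m_hom_i (X : bimodule S) : @is_bimod_hom S (Ti (Ti X)) (Ti X) (m X ∘ tV X).
Proof.
split; apply: (Rt_epi (X := X)); rnorm; rwF R (tK X).
- rw (act_i_m X). rwr (t_act_i X). by rw (tK X).
- rw (act0_i_m X). rwr (t_act0_i X). by rw (tK X).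
Qed.

Lemma mult_o_eq (X : bimodule S) :
  (pi_o_hom X ∘ m X) ∘ fmap T (act (Ti X)) = (pi_o_hom X ∘ m X) ∘ fmap T (act0 (Ti X)).
Proof.
apply: (l_epi (X := T X)); rnorm.
rwr (act_i_m X). rwr (act0_i_m X). by rw (coeq_o_eq X).
Qed.

Lemma mult_i_eq (X : bimodule S) :
  (pi_i_hom X ∘ (m X ∘ tV X)) ∘ fmap T (act (To X))
  = (pi_i_hom X ∘ (m X ∘ tV X)) ∘ fmap T (act0 (To X)).
Proof.
apply: (l_epi (X := T X)); apply: (Rt_epi (X := X)); rnorm.
rwr (t_m_phi X). rwr (t_act0_o X). rw (tK X). rw (tK X).
rwr (act_o_m X). rwr (act0_o_m X). by rw (coeq_i_eq X).
Qed.

Definition mult_o_hom (X : bimodule S) : bimod_hom (To (Tbar_o X)) (Tbar_o X) :=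
  bimod_desc (q := fmap To (pi_o X)) (T_pi_o_coeq X)
    (h := pi_o X ∘ BimodHom (m_hom_o X)) (mult_o_eq X).

Definition mult_i_hom (X : bimodule S) : bimod_hom (Ti (Tbar_i X)) (Tbar_i X) :=
  bimod_desc (q := fmap Ti (pi_i X)) (T_pi_i_coeq X)
    (h := pi_i X ∘ BimodHom (m_hom_i X)) (mult_i_eq X).

Lemma mult_o_homE (X : bimodule S) : mult_o_hom X ∘ fmap T (pi_o_hom X) = pi_o_hom X ∘ m X.
Proof. exact: (descE (T_pi_o_coeq X) (mult_o_eq X)). Qed.

Lemma mult_i_homE (X : bimodule S) :
  mult_i_hom X ∘ fmap T (pi_i_hom X) = pi_i_hom X ∘ (m X ∘ tV X).
Proof. exact: (descE (T_pi_i_coeq X) (mult_i_eq X)). Qed.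

Lemma tbar_o_eq (X : bimodule S) :
  mult_o_hom X ∘ act (Ti (Tbar_o X)) = mult_o_hom X ∘ act0 (Ti (Tbar_o X)).
Proof.
apply: (coeq_epi (bp_R_coeq (T_pi_o_coeq X))); rnorm.
rewrite /act_i; rnorm.
rw (n_l (pi_o_hom X)). rwFr T (pi_o_act X).
rwF T (n_phi (pi_o_hom X)). rw (n_m (pi_o_hom X)).
rw (mult_o_homE X). rw (mult_o_homE X). by rw (mmA X).
Qed.

Lemma tbar_i_eq (X : bimodule S) :
  mult_i_hom X ∘ act (To (Tbar_i X)) = mult_i_hom X ∘ act0 (To (Tbar_i X)).
Proof.
apply: (coeq_epi (bp_R_coeq (T_pi_i_coeq X))); apply: (Rt_epi (X := X)).
rewrite /= /act_o /act0_o; rnorm.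
rw (n_l (pi_i_hom X)). rwFr T (pi_i_act0 X).
rw (n_phi (fmap T (pi_i_hom X))). rw (n_m (pi_i_hom X)).
rw (mult_i_homE X). rw (mult_i_homE X).
rwr (t_act_o X). rw (tK X). rwr (t_m_phi0 X). rw (tK X).
rewrite /act_o; rnorm. by rw (mmA X).
Qed.

Definition tbar_o_hom (X : bimodule S) : bimod_hom (Tbar_o (Tbar_o X)) (Tbar_o X) :=
  bimod_desc (q := pi_o (Tbar_o X)) (pi_o_coeq (Tbar_o X)) (h := mult_o_hom X) (tbar_o_eq X).

Definition tbar_i_hom (X : bimodule S) : bimod_hom (Tbar_i (Tbar_i X)) (Tbar_i X) :=
  bimod_desc (q := pi_i (Tbar_i X)) (pi_i_coeq (Tbar_i X)) (h := mult_i_hom X) (tbar_i_eq X).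

Lemma tbar_o_homE (X : bimodule S) :
  tbar_o_hom X ∘ pi_o_hom (Tbar_o X) ∘ fmap T (pi_o_hom X) = pi_o_hom X ∘ m X.
Proof. by rewrite -mult_o_homE (descE (pi_o_coeq (Tbar_o X)) (tbar_o_eq X)). Qed.

Lemma tbar_i_homE (X : bimodule S) :
  tbar_i_hom X ∘ pi_i_hom (Tbar_i X) ∘ fmap T (pi_i_hom X) = pi_i_hom X ∘ m X ∘ tV X.
Proof.
by rewrite -(compmA (pi_i_hom X)) -mult_i_homE (descE (pi_i_coeq (Tbar_i X)) (tbar_i_eq X)).
Qed.

Definition tbar_o : nat_trans (Tbar_o ⋅ Tbar_o) Tbar_o.
Proof.
refine (@NatTrans _ _ (Tbar_o ⋅ Tbar_o) Tbar_o tbar_o_hom _).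
move=> X Y f; apply: bimod_hom_eq; apply: (coeq_epi (pi_o_coeq (Tbar_o X))).
apply: (coeq_epi (T_pi_o_coeq X)).
have eX := tbar_o_homE X; have eY := tbar_o_homE Y.
rnorm. rw (Tbar_o_mapE (fmap Tbar_o f)). rwF T (Tbar_o_mapE f).
rw eX. rw eY. rw (Tbar_o_mapE f). by rw (n_m f).
Defined.

Definition tbar_i : nat_trans (Tbar_i ⋅ Tbar_i) Tbar_i.
Proof.
refine (@NatTrans _ _ (Tbar_i ⋅ Tbar_i) Tbar_i tbar_i_hom _).
move=> X Y f; apply: bimod_hom_eq; apply: (coeq_epi (pi_i_coeq (Tbar_i X))).
apply: (coeq_epi (T_pi_i_coeq X)).
have eX := tbar_i_homE X; have eY := tbar_i_homE Y.
rnorm. rw (Tbar_i_mapE (fmap Tbar_i f)). rwF T (Tbar_i_mapE f).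
rw eX. rw eY. rw (Tbar_i_mapE f). rw (n_tV f). by rw (n_m f).
Defined.

Lemma tau_bar_o_is_hom (X : bimodule S) : @is_bimod_hom S X (Tbar_o X) (pi_o_hom X ∘ tau X).
Proof.
split; rnorm.
- rwr (pi_o_act X). rw (n_phi (tau X)). rw (mm1 X).
  rw (n_tau (act X)). rwr (l_tau X). rw (coeq_o_eq X). rw (l_tau X).
  rwr (n_tau (phi X)). by rw (mm1' X).
- rwr (pi_o_act0 X). rw (l_tau X). by rw (n_tau (act0 X)).
Qed.

Lemma tau_bar_i_is_hom (X : bimodule S) : @is_bimod_hom S X (Tbar_i X) (pi_i_hom X ∘ tau X).
Proof.
split; rnorm.
- rwr (pi_i_act X). rw (l_tau X). by rw (n_tau (act X)).
- rwr (pi_i_act0 X). rw (l_tau X). rwr (n_tau (phi X)). rw (mm1' X).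
  rw (n_tau (act0 X)). rwr (l_tau X). rwr (coeq_i_eq X). rw (n_phi (tau X)). by rw (mm1 X).
Qed.

Definition tau_bar_o : nat_trans (idF (bimod_cat S)) Tbar_o.
Proof.
refine (@NatTrans _ _ (idF (bimod_cat S)) Tbar_o (fun X => BimodHom (tau_bar_o_is_hom X)) _).
move=> X Y f; apply: bimod_hom_eq; rnorm.
rw (Tbar_o_mapE f). by rw (n_tau f).
Defined.

Definition tau_bar_i : nat_trans (idF (bimod_cat S)) Tbar_i.
Proof.
refine (@NatTrans _ _ (idF (bimod_cat S)) Tbar_i (fun X => BimodHom (tau_bar_i_is_hom X)) _).
move=> X Y f; apply: bimod_hom_eq; rnorm.
rw (Tbar_i_mapE f). by rw (n_tau f).
Defined.

Definition monad_o : monad_data (bimod_cat S) := MonadData tbar_o tau_bar_o.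
Definition monad_i : monad_data (bimod_cat S) := MonadData tbar_i tau_bar_i.

Definition Pi_coeq (X : bimodule S) : coequalizer (act X) (act0 X) := bp_coeq (act X) (act0 X).
Definition Pi_ob (X : bimodule S) : S := coeq_ob (Pi_coeq X).
Definition pPi (X : bimodule S) : Hom (bm_ob X) (Pi_ob X) := coeq_map (Pi_coeq X).

Lemma p_coeq (X : bimodule S) : is_coequalizer (act X) (act0 X) (pPi X).
Proof. exact: coeqP. Qed.

Lemma Pi_map_eq (X Y : bimodule S) (f : bimod_hom X Y) : (pPi Y ∘ f) ∘ act X = (pPi Y ∘ f) ∘ act0 X.
Proof.
have [f1 f2] := bimod_homP f; have e := coeq_eq (p_coeq Y).
by rnorm; rw f1; rw f2; rw e.
Qed.

Definition Pi_map (X Y : bimodule S) (f : bimod_hom X Y) : Hom (Pi_ob X) (Pi_ob Y) :=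
  desc (p_coeq X) (Pi_map_eq f).

Lemma Pi_mapE (X Y : bimodule S) (f : bimod_hom X Y) : Pi_map f ∘ pPi X = pPi Y ∘ f.
Proof. exact: descE. Qed.

Definition Pi : functor (bimod_cat S) S.
Proof.
refine (@Functor (bimod_cat S) S Pi_ob Pi_map _ _).
- by move=> X; apply: (coeq_epi (p_coeq X)); rewrite Pi_mapE; rnorm.
- move=> X Y Z g f; apply: (coeq_epi (p_coeq X)).
  by rewrite Pi_mapE; rnorm; rw (Pi_mapE f); rw (Pi_mapE g).
Defined.

Lemma i_eq (X : bimodule S) :
  (pPi (Tbar_i X) ∘ pi_i_hom X) ∘ act (Ti X) = (pPi (Tbar_i X) ∘ pi_i_hom X) ∘ act0 (Ti X).
Proof.
have [e1 e2] := bimod_homP (pi_i_hom X); have e := coeq_eq (p_coeq (Tbar_i X)).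
by rewrite -!compmA e1 e2 !compmA e.
Qed.

Lemma i_eq' (X : bimodule S) :
  desc (pi_o_coeq X) (i_eq X) ∘ act (Tbar_o X) = desc (pi_o_coeq X) (i_eq X) ∘ act0 (Tbar_o X).
Proof.
have d := descE (pi_o_coeq X) (i_eq X).
apply: (coeq_epi (bp_R_coeq (pi_o_coeq X))); rnorm.
rwr (pi_o_act X). rwr (pi_o_act0 X). rw d. rw d. by rw (coeq_i_eq X).
Qed.

Definition i_map (X : bimodule S) : Hom (Pi (Tbar_o X)) (Pi (Tbar_i X)) :=
  desc (p_coeq (Tbar_o X)) (i_eq' X).

Lemma i_mapE (X : bimodule S) :
  i_map X ∘ pPi (Tbar_o X) ∘ pi_o_hom X = pPi (Tbar_i X) ∘ pi_i_hom X.
Proof. by rewrite (descE (p_coeq (Tbar_o X)) (i_eq' X)) descE. Qed.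

Definition i_nat : nat_trans (Pi ⋅ Tbar_o) (Pi ⋅ Tbar_i).
Proof.
refine (@NatTrans _ _ (Pi ⋅ Tbar_o) (Pi ⋅ Tbar_i) i_map _).
move=> X Y f; apply: (coeq_epi (p_coeq (Tbar_o X))); apply: (coeq_epi (pi_o_coeq X)).
have eX := i_mapE X; have eY := i_mapE Y.
rnorm. rw (Pi_mapE (fmap Tbar_o f)). rw (Tbar_o_mapE f). rw eY.
rw eX. rw (Pi_mapE (fmap Tbar_i f)). by rw (Tbar_i_mapE f).
Defined.

Definition braided_septuple : septuple :=
  @Septuple (bimod_cat S) S monad_o monad_i Pi tbar i_nat.

End Construction.

(* Main.v *)
From mathcomp Require Import ssreflect ssrfun ssrbool.
Require Import Defs.

Set Implicit Arguments.
Unset Strict Implicit.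
Unset Printing Implicit Defensive.

(** Each structure map of the septuple is obtained by descending, along the
projections [pi_o] and [pi_i], a composite of [m], [tau], [t] and its inverse [tV]:
[tbar_o] lies under [m], [tbar_i] under [m ∘ tV], [tbar] under [t], both units
are [tau] followed by a projection, and [i_nat] lies under an identity once [pPi] is also applied. Since [T]
preserves coequalizers, the composites
  [pi (Tbar (Tbar X)) ∘ T (pi (Tbar X)) ∘ T (T (pi X))]
are epimorphisms, for any choice of the indices o and i. Precomposing an axiom of the
septuple with the appropriate one therefore reduces it to an identity about the
BD-law [t] on [T] alone:
- the monad [Tbar_o] inherits the axioms of [T], and the monad [Tbar_i] those of [T]
  with multiplication [m ∘ tV], which is associative because [tV] is again a BD-law;
- [tbar] is a distributive law because [t] distributes the monad with multiplication
  [m ∘ tV] over the one with multiplication [m]: the passage from [m] to [m ∘ tV]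
  costs one Yang-Baxter equation ([t_tV_YB]);
- the compatibility of [i_nat] with the multiplications says [m = m ∘ tV ∘ t].

The bimodule structures, [phi] and the distributive law [l] enter through the
existence of these descents.

For transposition morphisms, precomposing the multiplicative axiom with the
epimorphism [pi_i (Tbar_i X) ∘ T (pi_i X) ∘ t X] gives the stated identity: the
factor [t X] turns [m ∘ tV] into [m], and [tbar ∘ pi_i] is
[Tbar_o pi_i ∘ tprime]. *)

(* The descended maps are used only through the equations that characterize them;
   unification that unfolds them is prohibitively slow. *)
#[local] Opaque Tbar_o_ob Tbar_i_ob Tbar_o_map Tbar_i_map pi_o_hom pi_i_hom.
#[local] Opaque tbar_o_hom tbar_i_hom tbar_hom tprime_hom Pi_ob Pi_map pPi i_map.

Section InverseBraiding.
Variable S : braided_pair.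
Local Notation T := (bp_T S).
Local Notation m := (mmult (bp_T S)).
Local Notation tau := (munit (bp_T S)).
Local Notation t := (bp_t S).
Local Notation tV := (iso_inv (bp_t S)).

Lemma Tt_epi (X Z : S) (u v : Hom (T (T (T X))) Z) :
  u ∘ fmap T (t X) = v ∘ fmap T (t X) -> u = v.
Proof.
by move=> e; rewrite -(compm1 u) -(compm1 v) -(fmap1 T) -(tK' X) fmapM !compmA e.
Qed.

(** The next five lemmas, together, say that the inverse of a BD-law is a BD-law. *)
Lemma tV_tau (X : S) : tV X ∘ tau (T X) = fmap T (tau X).
Proof. by rewrite -t_tau' compmA tK comp1m. Qed.

Lemma tV_tau' (X : S) : tV X ∘ fmap T (tau X) = tau (T X).
Proof. by rewrite -t_tau compmA tK comp1m. Qed.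

Lemma tV_m (X : S) : tV X ∘ m (T X) = fmap T (m X) ∘ (tV (T X) ∘ fmap T (tV X)).
Proof.
apply: (Tt_epi (X := X)); apply: (t_epi (X := T X)); rnorm.
rwF T (tK X). rw (tK (T X)). rwr (t_m' X). by rw (tK X).
Qed.

Lemma tV_m' (X : S) : tV X ∘ fmap T (m X) = m (T X) ∘ (fmap T (tV X) ∘ tV (T X)).
Proof.
apply: (t_epi (X := T X)); apply: (Tt_epi (X := X)); rnorm.
rw (tK (T X)). rwF T (tK X). rwr (t_m X). by rw (tK X).
Qed.

Lemma tV_YB (X : S) :
  tV (T X) ∘ (fmap T (tV X) ∘ tV (T X)) = fmap T (tV X) ∘ (tV (T X) ∘ fmap T (tV X)).
Proof.
apply: (t_epi (X := T X)); apply: (Tt_epi (X := X)); apply: (t_epi (X := T X)); rnorm.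
rw (tK (T X)). rwF T (tK X). rw (tK (T X)). rw (t_YB X).
rwF T (tK X). rw (tK (T X)). by rwF T (tK X).
Qed.

(** The Yang-Baxter equation for [t] with one crossing inverted. It lets [t] slide
past the [tV] in the twisted multiplication [m ∘ tV]. *)
Lemma t_tV_YB (X : S) :
  t (T X) ∘ (fmap T (t X) ∘ tV (T X)) = fmap T (tV X) ∘ (t (T X) ∘ fmap T (t X)).
Proof.
apply: (t_epi (X := T X)); rnorm. rw (tK (T X)). rw (t_YB X). by rwF T (tK X).
Qed.

End InverseBraiding.

Section Septuple.
Variables (S : braided_pair) (phi : braid_preserving_morphism S).
Local Notation T := (bp_T S).
Local Notation m := (mmult (bp_T S)).
Local Notation tau := (munit (bp_T S)).
Local Notation t := (bp_t S).
Local Notation tV := (iso_inv (bp_t S)).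

Lemma TT_pi_o_epi (X : bimodule S) (Z : S) (u v : Hom (T (T (Tbar_o phi X))) Z) :
  u ∘ fmap T (fmap T (pi_o_hom phi X)) = v ∘ fmap T (fmap T (pi_o_hom phi X)) -> u = v.
Proof. exact: (coeq_epi (bp_T_coeq (T_pi_o_coeq phi X))). Qed.

Lemma TT_pi_i_epi (X : bimodule S) (Z : S) (u v : Hom (T (T (Tbar_i phi X))) Z) :
  u ∘ fmap T (fmap T (pi_i_hom phi X)) = v ∘ fmap T (fmap T (pi_i_hom phi X)) -> u = v.
Proof. exact: (coeq_epi (bp_T_coeq (T_pi_i_coeq phi X))). Qed.

(** Each axiom for [Tbar_o] is the image under the projections of the same axiom
for [T]. *)
Lemma monad_o_is_monad : is_monad (monad_o phi).
Proof.
split=> X; apply: bimod_hom_eq.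
- apply: (coeq_epi (pi_o_coeq phi (Tbar_o phi (Tbar_o phi X)))).
  apply: (coeq_epi (T_pi_o_coeq phi (Tbar_o phi X))); apply: TT_pi_o_epi.
  have e := tbar_o_homE phi X; have e' := tbar_o_homE phi (Tbar_o phi X).
  rnorm. rw (Tbar_o_mapE phi (tbar_o_hom phi X)). rwF T e. rw e.
  rw e'. rw (n_m (pi_o_hom phi X)). rw e. by rw (mmA X).
- apply: (coeq_epi (pi_o_coeq phi X)).
  have e := tbar_o_homE phi X.
  rnorm. rw (Tbar_o_mapE phi (tau_bar_o phi X)). rw e. by rw (mm1 X).
- apply: (coeq_epi (pi_o_coeq phi X)).
  have e := tbar_o_homE phi X.
  rnorm. rw (n_tau (pi_o_hom phi X)). rw e. by rw (mm1' X).
Qed.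

(** The projections reduce associativity to that of [m ∘ tV]. Both sides become
[m ∘ T m] after a product of three [tV], and these products agree by the Yang-Baxter
equation for [tV]. *)
Lemma monad_i_is_monad : is_monad (monad_i phi).
Proof.
split=> X; apply: bimod_hom_eq.
- apply: (coeq_epi (pi_i_coeq phi (Tbar_i phi (Tbar_i phi X)))).
  apply: (coeq_epi (T_pi_i_coeq phi (Tbar_i phi X))); apply: TT_pi_i_epi.
  have e := tbar_i_homE phi X; have e' := tbar_i_homE phi (Tbar_i phi X).
  rnorm. rw (Tbar_i_mapE phi (tbar_i_hom phi X)). rwF T e. rw e.
  rw e'. rw (n_tV (pi_i_hom phi X)). rw (n_m (pi_i_hom phi X)). rw e.
  rw (tV_m' X). rw (tV_m X). rwr (mmA X). by rw (tV_YB X).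
- apply: (coeq_epi (pi_i_coeq phi X)).
  have e := tbar_i_homE phi X.
  rnorm. rw (Tbar_i_mapE phi (tau_bar_i phi X)). rw e. rw (tV_tau' X). by rw (mm1' X).
- apply: (coeq_epi (pi_i_coeq phi X)).
  have e := tbar_i_homE phi X.
  rnorm. rw (n_tau (pi_i_hom phi X)). rw e. rw (tV_tau X). by rw (mm1 X).
Qed.

(** The projections carry the axioms of [t] to those of [tbar]. Only the compatibility
with [tbar_i] is not literally an axiom of [t]: it reads
[t ∘ (m ∘ tV) T = T (m ∘ tV) ∘ t T ∘ T t], that is, compatibility with [m]
corrected by [t_tV_YB]. *)
Lemma tbar_is_distributive_law :
  is_distributive_law (R := monad_i phi) (T := monad_o phi) (tbar phi).
Proof.
have et := tbar_homE phi; have eo := tbar_o_homE phi; have ei := tbar_i_homE phi.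
split=> X; apply: bimod_hom_eq.
- apply: (coeq_epi (pi_i_coeq phi (Tbar_i phi (Tbar_o phi X)))).
  apply: (coeq_epi (T_pi_i_coeq phi (Tbar_o phi X))); apply: TT_pi_o_epi.
  rnorm. rw (ei (Tbar_o phi X)). rw (n_tV (pi_o_hom phi X)). rw (n_m (pi_o_hom phi X)).
  rwr (et X). rw (t_m X).
  rw (Tbar_i_mapE phi (tbar_hom phi X)). rwFr T (et X).
  rwr (et (Tbar_i phi X)). rw (n_t (pi_i_hom phi X)).
  rw (Tbar_o_mapE phi (tbar_i_hom phi X)). rwF T (ei X).
  by rw (t_tV_YB X).
- apply: (coeq_epi (pi_i_coeq phi (Tbar_o phi (Tbar_o phi X)))).
  apply: (coeq_epi (T_pi_o_coeq phi (Tbar_o phi X))); apply: TT_pi_o_epi.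
  rnorm. rw (Tbar_i_mapE phi (tbar_o_hom phi X)). rwF T (eo X). rwr (et X). rw (t_m' X).
  rwr (et (Tbar_o phi X)). rw (n_t (pi_o_hom phi X)).
  rw (Tbar_o_mapE phi (tbar_hom phi X)). rwFr T (et X).
  rw (eo (Tbar_i phi X)). by rw (n_m (pi_i_hom phi X)).
- apply: (coeq_epi (pi_o_coeq phi X)).
  rnorm. rw (n_tau (pi_o_hom phi X)). rwr (et X). rw (t_tau X).
  by rw (Tbar_o_mapE phi (tau_bar_i phi X)).
- apply: (coeq_epi (pi_i_coeq phi X)).
  rnorm. rw (Tbar_i_mapE phi (tau_bar_o phi X)). rwr (et X). rw (t_tau' X).
  by rw (n_tau (pi_i_hom phi X)).
Qed.

Lemma i_nat_unit (X : bimodule S) :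
  i_nat phi X ∘ fmap (Pi S) (tau_bar_o phi X) = fmap (Pi S) (tau_bar_i phi X).
Proof.
apply: (coeq_epi (p_coeq X)).
have e := i_mapE phi X.
rnorm. rw (Pi_mapE (tau_bar_o phi X)). rw e. by rw (Pi_mapE (tau_bar_i phi X)).
Qed.

(** On the source [T (T X)], the right-hand side braids by [t] and then multiplies by
[m ∘ tV], so the two braidings cancel; each [i_nat] only switches from [pi_o] to
[pi_i]. *)
Lemma i_nat_mult (X : bimodule S) :
  i_nat phi X ∘ fmap (Pi S) (tbar_o phi X)
  = fmap (Pi S) (tbar_i phi X) ∘ i_nat phi (Tbar_i phi X) ∘ fmap (Pi S) (tbar phi X)
    ∘ i_nat phi (Tbar_o phi X).
Proof.
apply: (coeq_epi (p_coeq (Tbar_o phi (Tbar_o phi X)))).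
apply: (coeq_epi (pi_o_coeq phi (Tbar_o phi X))); apply: (coeq_epi (T_pi_o_coeq phi X)).
have ei := i_mapE phi.
rnorm. rw (Pi_mapE (tbar_o phi X)). rw (tbar_o_homE phi X). rw (ei X).
rw (ei (Tbar_o phi X)). rw (Pi_mapE (tbar phi X)). rwr (tbar_homE phi X).
rw (ei (Tbar_i phi X)). rw (Pi_mapE (tbar_i phi X)). rw (tbar_i_homE phi X). by rw (tK X).
Qed.

(** Only a reassociation, since [tau_bar_i] is [pi_i ∘ tau] by definition. *)
Lemma transposition_unitP (X : bimodule S) (w : Hom (Tbar_i phi X) (Tbar_o phi X)) :
  w ∘ tau_bar_i phi X = tau_bar_o phi X <->
  bm_hom (w ∘ pi_i phi X) ∘ tau X = bm_hom (tau_bar_o phi X).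
Proof.
split=> [e|e]; first by rewrite -e /= -compmA.
by apply: bimod_hom_eq; rewrite -e /= -compmA.
Qed.

(** The second equation is the first precomposed with
[pi_i (Tbar_i X) ∘ T (pi_i X) ∘ t X]. This is an epimorphism, so no information is
lost, and its last factor cancels the [tV] that the multiplication of [Tbar_i]
carries. *)
Lemma transposition_multP (X : bimodule S) (w : Hom (Tbar_i phi X) (Tbar_o phi X)) :
  let wt : Hom (Ti phi X) (Tbar_o phi X) := w ∘ pi_i phi X in
  w ∘ tbar_i phi X = tbar_o phi X ∘ fmap (Tbar_o phi) w ∘ tbar phi X ∘ fmap (Tbar_i phi) w
  <->
  bm_hom wt ∘ m X =
    bm_hom (tbar_o phi X) ∘ bm_hom (fmap (Tbar_o phi) wt) ∘ bm_hom (tprime phi X)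
    ∘ fmap T (bm_hom wt) ∘ t X.
Proof.
(* Push the test morphism through [tbar_i] on one side, through [tbar] on the other. *)
have lhsE : bm_hom w ∘ (tbar_i_hom phi X ∘ (pi_i_hom phi (Tbar_i phi X)
    ∘ (fmap T (pi_i_hom phi X) ∘ t X))) = bm_hom w ∘ (pi_i_hom phi X ∘ m X).
  by rw (tbar_i_homE phi X); rw (tK X).
have rhsE : tbar_hom phi X ∘ (Tbar_i_map phi w ∘ (pi_i_hom phi (Tbar_i phi X)
      ∘ (fmap T (pi_i_hom phi X) ∘ t X)))
    = Tbar_o_map phi (pi_i_hom phi X) ∘ (tprime_hom phi X
      ∘ (fmap T w ∘ (fmap T (pi_i_hom phi X) ∘ t X))).
  by rw (Tbar_i_mapE phi w); rw (tbar_homE' phi X).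
move=> wt; rewrite {}/wt fmapM; split=> e.
- move: (congr1 (@bm_hom _ _ _) e) => {}e; rewrite /= in e.
  move: (congr1 (fun f => f ∘ (pi_i_hom phi (Tbar_i phi X)
      ∘ (fmap T (pi_i_hom phi X) ∘ t X))) e).
  by rnorm; rewrite lhsE rhsE.
- apply: bimod_hom_eq; apply: (coeq_epi (pi_i_coeq phi (Tbar_i phi X))).
  apply: (coeq_epi (T_pi_i_coeq phi X)); apply: t_epi.
  by move: e; rnorm; rewrite lhsE rhsE.
Qed.

End Septuple.

Theorem theorem3p12 (S : braided_pair) (phi : braid_preserving_morphism S) :
  is_admissible (braided_septuple phi) /\
  forall (X : bimodule S) (w : Hom (Tbar_i phi X) (Tbar_o phi X)),
    is_transposition (S := braided_septuple phi) (X := X) w <->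
    let wt : Hom (Ti phi X) (Tbar_o phi X) := w ∘ pi_i phi X in
    bm_hom wt ∘ munit (bp_T S) X = bm_hom (tau_bar_o phi X) /\
    bm_hom wt ∘ mmult (bp_T S) X =
      bm_hom (tbar_o phi X) ∘ bm_hom (fmap (Tbar_o phi) wt) ∘ bm_hom (tprime phi X)
      ∘ fmap (bp_T S) (bm_hom wt) ∘ bp_t S X.
Proof.
split.
  split; [split; [exact: monad_o_is_monad | exact: monad_i_is_monad] | | |].
  - exact: tbar_is_distributive_law.
  - exact: i_nat_unit.
  - exact: i_nat_mult.
move=> X w; have [u1 u2] := transposition_unitP w; have [m1 m2] := transposition_multP w.
split=> [[eu em]|[eu em]]; split; [exact: u1|exact: m1|exact: u2|exact: m2].
Qed.
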